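(* Let $m,n\ge 2$ and $1\le p\le\infty$. Let $c_p^{\mathrm{qsym}}(m,n)$ be the smallest constant such that $$\Bigl\| \Bigl|\sum_{k=1}^m A_k\Bigr|_{\mathrm{qsym}} \Bigr\|_p\ \le\ c_p^{\mathrm{qsym}}(m,n)\,\Bigl\| \sum_{k=1}^m |A_k|_{\mathrm{qsym}} \Bigr\|_p\qquad\text{for all }A_1,\dots,A_m\in\mathbb{M}_n.$$ Then: (1) $c_1^{\mathrm{qsym}}(m,n)=1$; (2) $c_2^{\mathrm{qsym}}(m,n)\le \sqrt{\frac{1+\sqrt{\min\{m,2n\}}}{2}}$; (3) $c_\infty^{\mathrm{qsym}}(m,n)\le \sqrt{\min\{m,2n\}}$; (4) $c_p^{\mathrm{qsym}}(m,n)\le \bigl(\min\{m,2n\}\bigr)^{\frac12-\frac1{2p}}$ for all $1\le p\le\infty$.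
   Context: $\mathbb{M}_n$ is the set of $n\times n$ complex matrices, $Z^*$ is the conjugate transpose of $Z$, $|Z|:=(Z^*Z)^{1/2}$, and the quadratic symmetric modulus is $|Z|_{\mathrm{qsym}}:=\left(\frac{|Z|^2+|Z^*|^2}{2}\right)^{1/2}$. For $1\le p<\infty$, the Schatten $p$-norm is $\|X\|_p:=(\operatorname{Tr}|X|^p)^{1/p}$; $\|X\|_\infty$ is the operator norm (largest singular value), and $\frac1\infty=0$. *)

(* Defs.v *)
From mathcomp Require Import all_boot all_order all_algebra.
From mathcomp Require Import spectral complex.
From mathcomp Require Import all_classical all_reals all_analysis.

Set Implicit Arguments.
Unset Strict Implicit.
Unset Printing Implicit Defensive.

Import Order.TTheory GRing.Theory Num.Theory.

Local Open Scope classical_set_scope.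
Local Open Scope ring_scope.
Local Open Scope complex_scope.
Local Open Scope sesquilinear_scope.

(* Functional calculus f(A) of a Hermitian matrix A by a real function f:
   A is diagonalized in an orthonormal basis and f is applied to its
   eigenvalues, which are real.  The value is not meaningful for other A. *)
Definition mxfun (R : realType) (n : nat) (f : R -> R) (A : 'M[R[i]]_n)
    : 'M[R[i]]_n :=
  invmx (spectralmx A)
    *m diag_mx (map_mx (fun z => (f (complex.Re z))%:C) (spectral_diag A))
    *m spectralmx A.

Definition mxsqrt (R : realType) (n : nat) (A : 'M[R[i]]_n) : 'M[R[i]]_n :=
  mxfun Num.sqrt A.

Definition mxpowR (R : realType) (n : nat) (A : 'M[R[i]]_n) (p : R)
    : 'M[R[i]]_n :=
  mxfun (fun x => x `^ p) A.

Definition mxabs (R : realType) (n : nat) (Z : 'M[R[i]]_n) : 'M[R[i]]_n :=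
  mxsqrt (Z ^t* *m Z).

Definition mxabs_qsym (R : realType) (n : nat) (Z : 'M[R[i]]_n)
    : 'M[R[i]]_n :=
  mxsqrt (2^-1 *: (mxabs Z ^+ 2 + mxabs (Z ^t*) ^+ 2)).

(* The singular values of X are the eigenvalues of |X|. *)
Definition max_singular_value (R : realType) (n : nat) (X : 'M[R[i]]_n) : R :=
  \big[Num.max/0]_(i < n) complex.Re (spectral_diag (mxabs X) 0 i).

(* Only used for 1 <= p <= +oo; the value at -oo is a dummy. *)
Definition schatten_norm (R : realType) (n : nat) (p : \bar R)
    (X : 'M[R[i]]_n) : R :=
  match p with
  | EFin r => complex.Re (\tr (mxpowR (mxabs X) r)) `^ r^-1
  | +oo%E => max_singular_value X
  | -oo%E => 0
  end.

Definition qsym_triangle_constants (R : realType) (p : \bar R) (m n : nat)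
    : set R :=
  [set c : R | forall A : 'I_m -> 'M[R[i]]_n,
     schatten_norm p (mxabs_qsym (\sum_k A k)) <=
     c * schatten_norm p (\sum_k mxabs_qsym (A k))].

(* That this infimum is attained, hence is the smallest such constant, is
   not built in. *)
Definition c_qsym (R : realType) (p : \bar R) (m n : nat) : R :=
  inf (qsym_triangle_constants p m n).

(* Main.v *)
Require Import Defs.
From mathcomp Require Import all_boot all_order all_algebra.
From mathcomp Require Import spectral complex.
From mathcomp Require Import all_classical all_reals all_analysis.
From mathcomp Require Import ring lra.

(** The matrix T(Z) obtained by stacking Z over its adjoint Z^H and dividing
    by sqrt 2 depends additively on Z, and |Z|_qsym is the modulus |T(Z)|. So
    it suffices to compare X = sum_k T_k with B = sum_k |T_k| for rectangular
    matrices T_1, ..., T_m with n columns, and this works with N = min(m, n),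
    which is at most min(m, 2n).

    Take singular value decompositions T_k = W_k L_k F_k and X = V S G, where
    the W_k and V are partial isometries, F_k and G unitary, and L_k and S
    diagonal with the singular values. Reading off the j-th diagonal entry of
    V^H X G^H writes the singular value s_j of X as a sum over k and i of l_ki
    times an entry of V^H W_k times an entry of F_k G^H. Cauchy-Schwarz then
    gives s_j ^ 2 <= a_j b_j ([eigval_sqr_le_weights]), with the right weight
    b_j = (G B G^H)_jj and the left weight a_j = sum_k (V^H W_k L_k W_k^H
    V)_jj. By Jensen's inequality sum_j b_j ^ p <= Tr B ^ p
    ([right_weight_powR]). For the left weights there are two bounds, sum_j
    a_j ^ p <= N ^ (p - 1) Tr B ^ p with N = n because sum_j a_j <= Tr B
    ([left_weight_powR_dim]), and with N = m by convexity and McCarthy's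
    inequality sum_k Tr |T_k| ^ p <= Tr B ^ p ([left_weight_powR_num],
    [eigval_powR_superadd]). The geometric mean of the bounds on a and b gives
    the constant N ^ (1/2 - 1/(2p)) for finite p ([schatten_scalar]); for p =
    oo one compares maxima instead of sums.

    For p = 2 and N = n the sharper constant follows from the same weights,
    using that sum_j a_j <= sum_j b_j ([frobenius_scalar]). For N = m one
    expands the Hilbert-Schmidt norm of X into the inner products of the T_k
    and separates the diagonal terms ([sum_eigval_sqr_le_num]).

    For p = 1 the bound is 1, and no constant below 1 is admissible, as a
    family with a single nonzero member shows. *)

Set Implicit Arguments.
Unset Strict Implicit.
Unset Printing Implicit Defensive.

Import Order.TTheory GRing.Theory Num.Theory.

Local Open Scope classical_set_scope.
Local Open Scope ring_scope.
Local Open Scope complex_scope.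
Local Open Scope sesquilinear_scope.

(** * Real inequalities *)

Section RealInequalities.
Context {R : realType}.
Implicit Types (p t x a b : R).

(** A convex function lies above its tangents; for the power function this is
    Young's inequality applied to y and z ^ (p - 1). *)
Lemma powR_tangent p (y z : R) : 1 <= p -> 0 <= y -> 0 <= z ->
  z `^ p + p * z `^ (p - 1) * (y - z) <= y `^ p.
Proof.
move=> p1 y0 z0; have p0 : 0 < p by lra.
have zE := mulr_powRB1 z0 p0.
have [->|pn1] := eqVneq p 1; first by rewrite subrr powRr0 !powRr1 //; lra.
have p1' : 0 < p - 1 by rewrite subr_gt0 lt_def pn1.
have pn : p != 0 by rewrite gt_eqF.
have qn : p - 1 != 0 by rewrite gt_eqF.
have := conjugate_powR y0 (powR_ge0 z (p - 1)) p0 (divr_gt0 p0 p1').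
rewrite -powRrM [(p - 1) * _]mulrC divfK // => /(_ _)/wrap[].
  by field; apply/andP.
move=> Y; rewrite -subr_ge0 -(pmulr_rge0 _ (_ : 0 < p^-1)) ?invr_gt0 //.
have -> : p^-1 * (y `^ p - (z `^ p + p * z `^ (p - 1) * (y - z))) =
  y `^ p / p - z `^ p / p - y * z `^ (p - 1) + z * z `^ (p - 1) by field.
have E : z `^ p / (p / (p - 1)) = z `^ p - z `^ p / p by field; apply/andP.
by rewrite zE; lra.
Qed.

(** Jensen's inequality. Weights of total mass at most 1 suffice because the
    power function vanishes at 0, which may carry the missing mass. *)
Lemma jensen_powR {I : finType} p (w y : I -> R) : 1 <= p ->
  (forall i, 0 <= w i) -> (forall i, 0 <= y i) -> \sum_i w i <= 1 ->
  (\sum_i w i * y i) `^ p <= \sum_i w i * y i `^ p.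
Proof.
move=> p1 w0 y0 W; set z := \sum_i _.
have z0 : 0 <= z by apply: sumr_ge0 => i _; exact: mulr_ge0.
have zE : z * z `^ (p - 1) = z `^ p by apply: mulr_powRB1 => //; lra.
apply: (@le_trans _ _ (\sum_i w i * (z `^ p + p * z `^ (p - 1) * (y i - z))));
  last first.
  by apply: ler_sum => i _; apply: ler_wpM2l => //; exact: powR_tangent.
have E c d u : \sum_i w i * (c + d * (y i - u)) =
    (\sum_i w i) * c + d * (\sum_i w i * y i - u * \sum_i w i).
  rewrite mulrBr !mulr_sumr !mulr_suml -sumrB -big_split /=.
  by apply: eq_bigr => i _; ring.
rewrite E -/z.
have -> : p * z `^ (p - 1) * (z - z * (\sum_i w i)) =
  p * z `^ p * (1 - \sum_i w i).
  by rewrite -zE; ring.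
have := powR_ge0 z p; set q := z `^ p; set s := \sum_i w i in W *.
move=> q0; rewrite -subr_ge0.
have -> : s * q + p * q * (1 - s) - q = (p - 1) * (1 - s) * q by ring.
by apply: mulr_ge0 => //; apply: mulr_ge0; rewrite subr_ge0.
Qed.

Lemma powR_sum_le {I : finType} p (y : I -> R) :
  1 <= p -> (forall i, 0 <= y i) ->
  (\sum_i y i) `^ p <= #|I|%:R `^ (p - 1) * \sum_i y i `^ p.
Proof.
move=> p1 y0; have [/card0_eq I0|] := posnP #|I|.
  by rewrite !big_pred0 // powR0 ?mulr0 //; lra.
rewrite -(ltr0n R) => N0; set N : R := #|I|%:R in N0 *.
have Nn : N != 0 by rewrite gt_eqF.
have := @jensen_powR I p (fun=> N^-1) y p1.
rewrite -!mulr_sumr => J.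
have {J} : (N^-1 * \sum_i y i) `^ p <= N^-1 * \sum_i y i `^ p.
  apply: J => //; first by move=> i; rewrite invr_ge0 ltW.
  by rewrite sumr_const -mulr_natr -/N mulVf.
have S0 : 0 <= \sum_i y i by apply: sumr_ge0.
move=> J; rewrite -[\sum_i y i](mulVKf Nn) powRM ?mulr_ge0 ?invr_ge0
  ?(ltW N0) //.
have p0 : 0 < p by lra.
rewrite -(mulr_powRB1 (ltW N0) p0).
rewrite [N * _]mulrC -mulrA ler_wpM2l ?powR_ge0 //.
by apply: le_trans (ler_wpM2l (ltW N0) J) _; rewrite mulrA mulfV // mul1r.
Qed.

Lemma sum_powR_le {I : finType} p (y : I -> R) :
  1 <= p -> (forall i, 0 <= y i) ->
  \sum_i y i `^ p <= (\sum_i y i) `^ p.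
Proof.
move=> p1 y0; have S0 : 0 <= \sum_i y i by apply: sumr_ge0.
have p0 : 0 < p by lra.
rewrite -(mulr_powRB1 S0 p0) mulr_suml; apply: ler_sum => i _.
rewrite -(mulr_powRB1 (y0 i) p0) ler_wpM2l // ge0_ler_powR ?nnegrE //;
  first by lra.
by rewrite (bigD1 i) //= lerDl sumr_ge0.
Qed.

(** The square root of a * b is the infimum over t > 0 of (t * b + a / t) / 2,
    so a bound in terms of all t is a Cauchy-Schwarz bound. With [le_amgm]
    this lets Cauchy-Schwarz inequalities be proved and used one summand at a
    time. *)
Lemma le_sqr_mul x a b : 0 <= x -> 0 <= a -> 0 <= b ->
  (forall t, 0 < t -> 2 * x <= t * b + a / t) -> x ^+ 2 <= a * b.
Proof.
move=> x0 a0 b0 H; rewrite leNgt; apply/negP => lt.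
have xp : 0 < x by rewrite lt_def x0 andbT; apply/eqP => xE; move: lt;
  rewrite xE; nra.
set d := (x ^+ 2 - a * b) / (b + 1).
have d0 : 0 < d by rewrite divr_gt0 // ?subr_gt0 //; lra.
have dE : d * (b + 1) = x ^+ 2 - a * b by rewrite divfK //; lra.
have adp : 0 < a + d by lra.
have := H ((a + d) / x) (divr_gt0 adp xp).
have -> : (a + d) / x * b + a / ((a + d) / x) =
  ((a + d) * b) / x + x * (a / (a + d)).
  by field; rewrite !gt_eqF.
have : ((a + d) * b) / x < x by rewrite ltr_pdivrMr //; nra.
have : x * (a / (a + d)) <= x * 1.
  by rewrite ler_wpM2l // ler_pdivrMr //; lra.
by lra.
Qed.

Lemma le_amgm x a b t : 0 <= a -> 0 <= b -> 0 < t -> x ^+ 2 <= a * b ->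
  2 * x <= t * b + a / t.
Proof.
move=> a0 b0 t0 H; have s0 : 0 <= t * b + a / t.
  by rewrite addr_ge0 // ?mulr_ge0 ?invr_ge0 // ltW.
have [x0|x0] := lerP x 0; first by apply: le_trans s0; lra.
rewrite -(ler_pXn2r (n := 2)) ?nnegrE //; last by lra.
rewrite exprMn -subr_ge0; set u := t * b; set v := a / t.
have E : a * b = u * v by rewrite /u /v; field; rewrite gt_eqF.
rewrite E in H; have -> : (u + v) ^+ 2 - 2 ^+ 2 * x ^+ 2 =
  (u - v) ^+ 2 + 4 * (u * v - x ^+ 2) by ring.
by rewrite addr_ge0 ?sqr_ge0 // mulr_ge0 // subr_ge0.
Qed.

(** Here s, a, b will be the singular values of a sum of matrices and its left
    and right weights. The bound on s ^ p is the geometric mean of the bounds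
    on a ^ p and b ^ p, which is where half of the exponent (p - 1) / p comes
    from. *)
Lemma schatten_scalar {I : finType} (N : nat) p (S : R) (s a b : I -> R) :
  (0 < N)%N -> 1 <= p -> 0 <= S ->
  (forall j, 0 <= s j) -> (forall j, 0 <= a j) -> (forall j, 0 <= b j) ->
  (forall j, s j ^+ 2 <= a j * b j) ->
  \sum_j b j `^ p <= S -> \sum_j a j `^ p <= N%:R `^ (p - 1) * S ->
  (\sum_j s j `^ p) `^ p^-1 <= N%:R `^ (2^-1 - (2 * p)^-1) * S `^ p^-1.
Proof.
move=> N0 p1 S0 s0 a0 b0 sab bS aS; have p0 : 0 < p by lra.
have NR : (0 : R) < N%:R by rewrite ltr0n.
set t : R := N%:R `^ ((p - 1) / 2).
have t0 : 0 < t by rewrite powR_gt0.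
have tsq : N%:R `^ (p - 1) = t * t.
  rewrite /t -powRD; last by apply/implyP => _; rewrite gt_eqF.
  suff -> : (p - 1) / 2 + (p - 1) / 2 = p - 1 by [].
  by field.
have key : \sum_j s j `^ p <= t * S.
  have : 2 * \sum_j s j `^ p <= t * (\sum_j b j `^ p) + (\sum_j a j `^ p) / t.
    rewrite !mulr_sumr mulr_suml -big_split /=; apply: ler_sum => j _.
    apply: le_amgm; rewrite ?powR_ge0 //.
    rewrite expr2 -!powRM // -expr2 ge0_ler_powR ?nnegrE ?sqr_ge0 ?mulr_ge0 //.
    exact: ltW.
  have : (\sum_j a j `^ p) / t <= t * S.
    by rewrite ler_pdivrMr // mulrAC -tsq.
  have : t * (\sum_j b j `^ p) <= t * S by rewrite ler_pM2l.
  by lra.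
have pV : 0 <= p^-1 by rewrite invr_ge0 ltW.
apply: (@le_trans _ _ ((t * S) `^ p^-1)).
  rewrite ge0_ler_powR ?nnegrE ?mulr_ge0 ?sumr_ge0 // ?(ltW t0) ?(ltW p0) //.
  by move=> j _; rewrite powR_ge0.
rewrite powRM ?(ltW t0) // /t -powRrM.
suff -> : (p - 1) / 2 / p = 2^-1 - (2 * p)^-1 by [].
by field; rewrite gt_eqF.
Qed.

(** For t > 0 the bound s_j <= sqrt (a_j b_j) gives 2 s_j ^ 2 <= t a_j + s_j ^
    2 b_j / t. Summing and using the bound on the sum of the a_j turns the
    right-hand side into the pairing of b with the vector c_j = t + s_j ^ 2 /
    t, and Cauchy-Schwarz is applied to that pairing. *)
Lemma frobenius_scalar n (s a b : 'I_n -> R) : (0 < n)%N ->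
  (forall j, 0 <= s j) -> (forall j, 0 <= a j) -> (forall j, 0 <= b j) ->
  (forall j, s j ^+ 2 <= a j * b j) -> \sum_j a j <= \sum_j b j ->
  \sum_j s j ^+ 2 <= (1 + Num.sqrt n%:R) / 2 * \sum_j b j ^+ 2.
Proof.
move=> n0 s0 a0 b0 sab ab; set r := Num.sqrt n%:R.
have r0 : 0 < r by rewrite sqrtr_gt0 ltr0n.
have rr : r * r = n%:R by rewrite -expr2 sqr_sqrtr // ler0n.
set S := \sum_j s j ^+ 2; set B := \sum_j b j ^+ 2.
have B0 : 0 <= B by apply: sumr_ge0 => j _; rewrite sqr_ge0.
have : 0 <= S by apply: sumr_ge0 => j _; rewrite sqr_ge0.
rewrite le_eqVlt => /predU1P[<-|S0].
  by rewrite mulr_ge0 // divr_ge0 //; lra.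
(* This t balances n t ^ 2 and S ^ 2 / t ^ 2 in the bound on the c_j ^ 2. *)
set t := Num.sqrt (S / r).
have t0 : 0 < t by rewrite sqrtr_gt0 divr_gt0.
have tsq : t * t = S / r by rewrite -expr2 sqr_sqrtr // ltW // divr_gt0.
pose c j := t + s j ^+ 2 / t.
have h1 : 2 * S <= \sum_j c j * b j.
  apply: (@le_trans _ _ (\sum_j (t * a j + s j ^+ 2 * b j / t))).
    rewrite /S mulr_sumr; apply: ler_sum => j _.
    apply: le_amgm => //; first by rewrite mulr_ge0 ?sqr_ge0.
    have -> : s j ^+ 2 * b j * a j = s j ^+ 2 * (a j * b j) by ring.
    by rewrite [_ ^+ 2 ^+ 2]expr2 ler_wpM2l ?sqr_ge0.
  rewrite big_split /= -mulr_sumr; apply: (@le_trans _ _ (t * \sum_j b j +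
    \sum_j s j ^+ 2 * b j / t)).
    by rewrite lerD2r ler_pM2l.
  by rewrite mulr_sumr -big_split /= ler_sum // => j _;
    rewrite /c mulrDl [_ / t * _]mulrAC.
have h2 : \sum_j c j ^+ 2 <= S * (2 + 2 * r).
  have -> : \sum_j c j ^+ 2 = n%:R * (t * t) + 2 * S +
    (\sum_j (s j ^+ 2) ^+ 2) / (t * t).
    rewrite mulr_suml mulr_sumr -[n in n%:R]card_ord mulrC mulr_natr
      -sumr_const -!big_split /=.
    by apply: eq_bigr => j _; rewrite /c; field; rewrite gt_eqF.
  have h : \sum_j (s j ^+ 2) ^+ 2 <= S * S.
    rewrite {1}/S mulr_suml; apply: ler_sum => j _.
    rewrite expr2 ler_wpM2l ?sqr_ge0 // /S (bigD1 j) //= lerDl sumr_ge0 //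
      => i _.
    by rewrite sqr_ge0.
  have : (\sum_j (s j ^+ 2) ^+ 2) / (t * t) <= S * r.
    rewrite tsq ler_pdivrMr ?divr_gt0 //.
    apply: le_trans h _; suff -> : S * r * (S / r) = S * S by [].
    by field; rewrite gt_eqF.
  have -> : n%:R * (t * t) = S * r by rewrite tsq -rr; field; rewrite gt_eqF.
  by lra.
have e0 : 0 < 1 + r by lra.
have h3 : 2 * (\sum_j c j * b j) <= (1 + r) * B + (\sum_j c j ^+ 2) / (1 + r).
  rewrite !mulr_sumr mulr_suml -big_split /=; apply: ler_sum => j _.
  by apply: le_amgm; rewrite ?sqr_ge0 // exprMn.
have : (\sum_j c j ^+ 2) / (1 + r) <= 2 * S.
  rewrite ler_pdivrMr //; apply: le_trans h2 _; lra.
by lra.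
Qed.
End RealInequalities.

(** * Functional calculus of Hermitian matrices *)

Section Hermitian.
Context {R : realType}.
Local Notation C := (R[i]).

Definition sqmod (z : C) : R := complex.Re z ^+ 2 + complex.Im z ^+ 2.

Lemma sqmod_ge0 z : 0 <= sqmod z.
Proof. by rewrite addr_ge0 ?sqr_ge0. Qed.

Lemma mulC_conj (z : C) : z * Num.conj z = (sqmod z)%:C.
Proof. by rewrite -normCK -add_Re2_Im2. Qed.

Lemma sqmod_conj (z : C) : sqmod (Num.conj z) = sqmod z.
Proof. by case: z => a b; rewrite /sqmod /= sqrrN. Qed.

Lemma Re_sum (I : finType) (F : I -> C) :
  complex.Re (\sum_i F i) = \sum_i complex.Re (F i).
Proof. by apply: (big_morph (@complex.Re R)) => // -[a b] [c d]. Qed.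

Lemma Re_scale (r : R) (z : C) : complex.Re (r%:C * z) = r * complex.Re z.
Proof. by case: z => a b /=; rewrite mul0r subr0. Qed.

Lemma real_complex_sum (I : finType) (F : I -> R) :
  (\sum_i F i)%:C = \sum_i (F i)%:C :> C.
Proof. exact: rmorph_sum. Qed.

Lemma Re_mul_le (z w : C) t : 0 < t ->
  2 * complex.Re (z * w) <= t * sqmod w + sqmod z / t.
Proof.
move=> t0; case: z w => a b [c d]; rewrite /sqmod /=.
have h1 : 2 * (a * c) <= t * c ^+ 2 + a ^+ 2 / t.
  by apply: le_amgm; rewrite ?sqr_ge0 ?exprMn.
have h2 : 2 * (- b * d) <= t * d ^+ 2 + b ^+ 2 / t.
  by apply: le_amgm; rewrite ?sqr_ge0 ?exprMn ?sqrrN.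
by lra.
Qed.

Definition rdiag n (l : 'I_n -> R) : 'M[C]_n := diag_mx (\row_j (l j)%:C).

Lemma rdiagE n (l : 'I_n -> R) i j : rdiag l i j = (l i)%:C *+ (i == j).
Proof. by rewrite !mxE; case: eqP => // ->. Qed.

Lemma eq_rdiag n (l k : 'I_n -> R) : l =1 k -> rdiag l = rdiag k.
Proof. by move=> e; apply/matrixP => i j; rewrite !rdiagE e. Qed.

Lemma rdiagM n (l k : 'I_n -> R) : rdiag l *m rdiag k = rdiag (fun i =>
  l i * k i).
Proof.
rewrite /rdiag mulmx_diag; congr diag_mx; apply/rowP => i.
by rewrite !mxE -rmorphM.
Qed.

Lemma ctrmxM m n p (A : 'M[C]_(m, n)) (B : 'M[C]_(n, p)) :
  (A *m B) ^t* = B ^t* *m A ^t*.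
Proof. by rewrite trmx_mul map_mxM. Qed.

Lemma ctrmx_sum (I : finType) m n (A : I -> 'M[C]_(m, n)) :
  (\sum_k A k) ^t* = \sum_k (A k) ^t*.
Proof. by rewrite linear_sum map_mx_sum. Qed.

Lemma ctrmx_rdiag n (l : 'I_n -> R) : (rdiag l) ^t* = rdiag l.
Proof.
apply/matrixP => i j; rewrite !mxE eq_sym; case: eqP => [->|_];
  last by rewrite conjC0.
by apply: conj_Creal; apply/complex_realP; eexists.
Qed.

Lemma mul_mx_rdiag r n (M : 'M[C]_(r, n)) l i j :
  (M *m rdiag l) i j = M i j * (l j)%:C.
Proof. by rewrite mul_mx_diag !mxE. Qed.

Lemma mul_rdiag_mx r n (M : 'M[C]_(r, n)) l i j :
  (rdiag l *m M) i j = (l i)%:C * M i j.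
Proof. by rewrite mul_diag_mx !mxE. Qed.

Lemma rdiag_form r n (M : 'M[C]_(r, n)) l j :
  (M *m rdiag l *m M ^t*) j j = (\sum_i l i * sqmod (M j i))%:C.
Proof.
rewrite mxE real_complex_sum; apply: eq_bigr => i _.
by rewrite mul_mx_rdiag !mxE rmorphM /= -mulC_conj; ring.
Qed.

Lemma gram_diag r n (M : 'M[C]_(r, n)) j :
  (M ^t* *m M) j j = (\sum_i sqmod (M i j))%:C.
Proof.
rewrite mxE real_complex_sum; apply: eq_bigr => i _.
by rewrite !mxE mulrC mulC_conj.
Qed.

Lemma gram_eq0 r n (M : 'M[C]_(r, n)) : M ^t* *m M = 0 -> M = 0.
Proof.
move=> M0; apply/matrixP => i j; have := gram_diag M j;
  rewrite M0 !mxE => /esym.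
move=> /(congr1 (@complex.Re R)) /= /eqP.
rewrite psumr_eq0 => [|k _]; last exact: sqmod_ge0.
move=> /allP/(_ i (mem_index_enum _))/=; rewrite /sqmod paddr_eq0 ?sqr_ge0 //.
by rewrite !sqrf_eq0; case: (M i j) => a b /= /andP[/eqP-> /eqP->].
Qed.

Definition eigval n (A : 'M[C]_n) (j : 'I_n) : R :=
  complex.Re (spectral_diag A 0 j).

(** The quadratic form of a Hermitian matrix takes real values, so its real
    part is all of it. *)
Definition psd n (A : 'M[C]_n) : Prop :=
  A ^t* = A /\ forall u : 'rV[C]_n, 0 <= complex.Re ((u *m A *m u ^t*) 0 0).

Lemma unitaryK n (P : 'M[C]_n) : P \is unitarymx -> P ^t* *m P = 1%:M.
Proof. by move=> /unitarymxP h; apply: mulmx1C. Qed.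

Lemma spectral_diag_rdiag n (A : 'M[C]_n) : A ^t* = A ->
  diag_mx (spectral_diag A) = rdiag (eigval A).
Proof.
move=> Ah; have hA : A \is hermsymmx.
  by apply/is_hermitianmxP; rewrite expr0 scale1r Ah.
apply/matrixP => i j; rewrite rdiagE mxE; congr (_ *+ _).
by apply/esym/RRe_real; exact: (mxOverP (hermitian_spectral_diag_real hA)).
Qed.

Lemma herm_spectral n (A : 'M[C]_n) : A ^t* = A ->
  A = (spectralmx A) ^t* *m rdiag (eigval A) *m spectralmx A.
Proof.
move=> Ah; have hA : A \is hermsymmx.
  by apply/is_hermitianmxP; rewrite expr0 scale1r Ah.
have := orthomx_spectralP (hermitian_normalmx hA).
rewrite /= (invmx_unitary (spectral_unitarymx A)).
by rewrite spectral_diag_rdiag.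
Qed.

Lemma mxfunE n (A : 'M[C]_n) (f : R -> R) :
  mxfun f A = (spectralmx A) ^t* *m rdiag (f \o eigval A) *m spectralmx A.
Proof.
have iE := invmx_unitary (spectral_unitarymx A).
rewrite /mxfun iE.
have -> : diag_mx (map_mx (fun z => (f (complex.Re z))%:C) (spectral_diag A)) =
  rdiag (f \o eigval A).
  by apply/matrixP => i j; rewrite rdiagE !mxE.
by [].
Qed.

(** The functional calculus does not depend on the diagonalization: if M
    carries one diagonalization to another, then l_i M_ij = k_j M_ij for the
    two lists of eigenvalues, so M_ij = 0 unless l_i = k_j, and hence f l_i
    M_ij = f k_j M_ij. *)
Lemma mxfun_diag n (A P : 'M[C]_n) l (f : R -> R) : P \is unitarymx ->
  A = P ^t* *m rdiag l *m P -> mxfun f A = P ^t* *m rdiag (f \o l) *m P.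
Proof.
move=> Pu AE; have Ah : A ^t* = A.
  by rewrite AE !ctrmxM ctrmx_rdiag trmxCK mulmxA.
have := herm_spectral Ah; set S := spectralmx A => AS.
have Su : S \is unitarymx := spectral_unitarymx A.
rewrite mxfunE -/S.
pose M := S *m P ^t*.
have SE : S = M *m P by rewrite /M -mulmxA unitaryK // mulmx1.
have PE : P ^t* = S ^t* *m M by rewrite /M mulmxA unitaryK // mul1mx.
have comm : rdiag (eigval A) *m M = M *m rdiag l.
  have E1 : S *m A = rdiag (eigval A) *m S.
    by rewrite [X in _ *m X]AS !mulmxA (unitarymxP Su) mul1mx.
  have E2 : A *m P ^t* = P ^t* *m rdiag l.
    by rewrite [X in X *m _]AE -!mulmxA (unitarymxP Pu) mulmx1.
  by rewrite /M mulmxA -E1 -!mulmxA E2.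
clearbody M; have comm2 : rdiag (f \o eigval A) *m M = M *m rdiag (f \o l).
  apply/matrixP => i j; have /matrixP/(_ i j) := comm.
  rewrite !mul_mx_rdiag !mul_rdiag_mx /=.
  rewrite mulrC => /eqP; rewrite -subr_eq0 -mulrBr mulf_eq0 => /orP[/eqP->|].
    by rewrite mulr0 mul0r.
  by rewrite subr_eq0 => /eqP/complexI ->; rewrite mulrC.
by rewrite PE -(mulmxA _ M) -comm2 -!mulmxA -SE.
Qed.

Lemma row_form r n (M : 'M[C]_(r, n)) A j :
  (row j M *m A *m (row j M) ^t*) 0 0 = (M *m A *m M ^t*) j j.
Proof.
rewrite -row_mul mxE [RHS]mxE; apply: eq_bigr => k _.
by rewrite !mxE.
Qed.

Lemma eigval_diag n (A : 'M[C]_n) j : A ^t* = A ->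
  complex.Re ((spectralmx A *m A *m (spectralmx A) ^t*) j j) = eigval A j.
Proof.
move=> Ah; have /unitarymxP Su := spectral_unitarymx A.
rewrite [X in _ *m X *m _](herm_spectral Ah) !mulmxA Su.
by rewrite mul1mx -mulmxA Su mulmx1 rdiagE eqxx.
Qed.

Lemma psd_form_diag r n (A : 'M[C]_n) (M : 'M[C]_(r, n)) j : psd A ->
  0 <= complex.Re ((M *m A *m M ^t*) j j).
Proof.
by move=> [_ /(_ (row j M))]; rewrite row_form.
Qed.

Lemma eigval_ge0 n (A : 'M[C]_n) j : psd A -> 0 <= eigval A j.
Proof. by move=> Ap; rewrite -(eigval_diag j Ap.1) psd_form_diag. Qed.

Lemma psd_gram r n (T : 'M[C]_(r, n)) : psd (T ^t* *m T).
Proof.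
split=> [|u]; first by rewrite ctrmxM trmxCK.
have -> : u *m (T ^t* *m T) *m u ^t* = (T *m u ^t*) ^t* *m (T *m u ^t*).
  by rewrite ctrmxM trmxCK !mulmxA.
by rewrite gram_diag /= sumr_ge0 // => i _; exact: sqmod_ge0.
Qed.

Lemma psd_sum (I : finType) n (B : I -> 'M[C]_n) : (forall k, psd (B k)) ->
  psd (\sum_k B k).
Proof.
move=> Bp; split=> [|u].
  by rewrite ctrmx_sum; apply: eq_bigr => k _; have [] := Bp k.
rewrite mulmx_sumr mulmx_suml summxE Re_sum sumr_ge0 // => k _.
by have [_] := Bp k.
Qed.

Lemma psd_conj_rdiag n (P : 'M[C]_n) l : (forall j, 0 <= l j) ->
  psd (P ^t* *m rdiag l *m P).
Proof.
move=> l0; split=> [|u]; first by rewrite !ctrmxM ctrmx_rdiag trmxCK mulmxA.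
have -> : u *m (P ^t* *m rdiag l *m P) *m u ^t* =
  (u *m P ^t*) *m rdiag l *m (u *m P ^t*) ^t*.
  by rewrite ctrmxM trmxCK !mulmxA.
by rewrite rdiag_form /= sumr_ge0 // => i _; rewrite mulr_ge0 // sqmod_ge0.
Qed.

Lemma conj_rdiagM n (P : 'M[C]_n) l k : P \is unitarymx ->
  P ^t* *m rdiag l *m P *m (P ^t* *m rdiag k *m P) =
  P ^t* *m rdiag (fun j => l j * k j) *m P.
Proof.
move=> /unitarymxP Pu; rewrite !mulmxA -(mulmxA _ P (P ^t*)) Pu mulmx1.
by rewrite -(mulmxA _ (rdiag l)) rdiagM.
Qed.

Lemma mxsqrtP n (A : 'M[C]_n) : psd A ->
  psd (mxsqrt A) /\ mxsqrt A *m mxsqrt A = A.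
Proof.
move=> Ap; have Su := spectral_unitarymx A.
rewrite /mxsqrt mxfunE; split.
  by apply: psd_conj_rdiag => j; rewrite sqrtr_ge0.
rewrite conj_rdiagM // [RHS](herm_spectral Ap.1) (@eq_rdiag _ _ (eigval A)) //
  => j /=.
by rewrite -expr2 sqr_sqrtr // eigval_ge0.
Qed.

Lemma herm_sqr n (B : 'M[C]_n) : B ^t* = B ->
  B *m B = (spectralmx B) ^t* *m rdiag (fun j =>
    eigval B j * eigval B j) *m spectralmx B.
Proof.
move=> Bh; have Su := spectral_unitarymx B.
by rewrite {1 2}(herm_spectral Bh) conj_rdiagM.
Qed.

Lemma mxabs_id n (B : 'M[C]_n) : psd B -> mxabs B = B.
Proof.
move=> Bp; have Bh := Bp.1; rewrite /mxabs Bh /mxsqrt.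
have Su := spectral_unitarymx B; set S := spectralmx B in Su.
rewrite (mxfun_diag _ Su (herm_sqr Bh)) [RHS](herm_spectral Bh).
rewrite (@eq_rdiag _ _ (eigval B)) // => j /=.
by rewrite -expr2 sqrtr_sqr ger0_norm // eigval_ge0.
Qed.

Lemma schatten_norm_psd n (B : 'M[C]_n) r : psd B ->
  schatten_norm r%:E B = (\sum_j eigval B j `^ r) `^ r^-1.
Proof.
move=> Bp /=; rewrite mxabs_id // /mxpowR.
have Su := spectral_unitarymx B.
rewrite (mxfun_diag _ Su (herm_spectral Bp.1)) -mulmxA mxtrace_mulC -mulmxA.
rewrite (unitarymxP Su) mulmx1 Re_sum; congr (_ `^ _).
by apply: eq_bigr => j _; rewrite rdiagE eqxx.
Qed.

Lemma schatten_norm_psdy n (B : 'M[C]_n) : psd B ->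
  schatten_norm +oo%E B = \big[Num.max/0]_j eigval B j.
Proof. by move=> Bp /=; rewrite /max_singular_value mxabs_id. Qed.
End Hermitian.

(** * Singular value decomposition and partial isometries *)

Section PartialIsometries.
Context {R : realType}.
Local Notation C := (R[i]).

Definition partial_isometry r n (W : 'M[C]_(r, n)) : Prop :=
  W *m W ^t* *m W = W.

Lemma sqmod_ctrmx m n (A : 'M[C]_(m, n)) i j : sqmod ((A ^t*) i j) =
  sqmod (A j i).
Proof. by rewrite !mxE sqmod_conj. Qed.

Lemma ctrmxB m n (A B : 'M[C]_(m, n)) : (A - B) ^t* = A ^t* - B ^t*.
Proof. by rewrite linearB map_mxB. Qed.

Lemma spectralmxK n (A : 'M[C]_n) : (spectralmx A) ^t* *m spectralmx A = 1%:M.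
Proof. exact: unitaryK (spectral_unitarymx A). Qed.

Lemma spectralmxKV n (A : 'M[C]_n) : spectralmx A *m (spectralmx A) ^t* = 1%:M.
Proof. exact: unitarymxP (spectral_unitarymx A). Qed.

(** The singular value decomposition of T when B = |T|. It is taken with W a
    partial isometry because T may have a kernel: W is T times the adjoint of
    the eigenvector matrix times the pseudo-inverse of the eigenvalues. *)
Lemma polar_psd r n (T : 'M[C]_(r, n)) (B : 'M[C]_n) : psd B ->
  B *m B = T ^t* *m T ->
  exists W : 'M[C]_(r, n),
    [/\ T = W *m rdiag (eigval B) *m spectralmx B, partial_isometry W &
        W ^t* *m W *m rdiag (eigval B) = rdiag (eigval B)].
Proof.
move=> Bp BT; set S := spectralmx B; set l := eigval B.
have SS : S *m S ^t* = 1%:M := spectralmxKV B.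
have SK : S ^t* *m S = 1%:M := spectralmxK B.
have gramE : (T *m S ^t*) ^t* *m (T *m S ^t*) = rdiag (fun i => l i * l i).
  rewrite ctrmxM trmxCK !mulmxA -[S *m _ *m T]mulmxA -BT.
  rewrite (herm_sqr Bp.1) -/S -/l !mulmxA SS mul1mx.
  by rewrite -mulmxA SS mulmx1.
pose e i : R := (l i != 0)%:R.
set Y := T *m S ^t* in gramE *.
have kerE : Y *m rdiag e = Y.
  apply/eqP; rewrite eq_sym -subr_eq0; apply/eqP/gram_eq0.
  have -> : Y - Y *m rdiag e = Y *m rdiag (fun i => 1 - e i).
    apply/matrixP => i j; rewrite [LHS]mxE [X in _ + X]mxE !mul_mx_rdiag.
    by rewrite rmorphB rmorph1 mulrBr mulr1.
  rewrite ctrmxM ctrmx_rdiag mulmxA -(mulmxA _ _ Y) gramE !rdiagM.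
  apply/matrixP => i j; rewrite rdiagE mxE /e.
  by have [->|ln] := eqVneq (l i) 0; rewrite /= ?mulr0 ?mul0r ?subrr ?mul0r
    mul0rn.
have gramE' q (D : 'M[C]_(q, n)) : D *m Y ^t* *m Y = D *m rdiag (fun i =>
  l i * l i) by rewrite -mulmxA gramE.
have YE : T *m S ^t* = Y by []; clearbody Y.
exists (Y *m rdiag (fun i => (l i)^-1)); split.
- rewrite -[_ *m rdiag l]mulmxA rdiagM -[T in LHS]mulmx1 -SK mulmxA YE -{1}kerE.
  congr (_ *m _ *m _); apply: eq_rdiag => i; rewrite /e.
  by have [->|ln] := eqVneq (l i) 0; rewrite ?mulr0 // mulVf.
- rewrite /partial_isometry ctrmxM ctrmx_rdiag !mulmxA gramE'.
  rewrite -!mulmxA !rdiagM; congr (_ *m _); apply: eq_rdiag => i.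
  by have [->|ln] := eqVneq (l i) 0; rewrite ?invr0 ?mul0r //; field.
- rewrite ctrmxM ctrmx_rdiag mulmxA gramE' !rdiagM.
  apply: eq_rdiag => i.
  by have [->|ln] := eqVneq (l i) 0; rewrite ?invr0 ?mul0r ?mulr0 //; field.
Qed.

(** The Gram matrix of W is an orthogonal projection, and the diagonal entries
    of a projection lie between 0 and 1. *)
Lemma partial_isometry_col r n (W : 'M[C]_(r, n)) i : partial_isometry W ->
  \sum_j sqmod (W j i) <= 1.
Proof.
move=> h; set s := \sum_j _; have sE := gram_diag W i.
set G := W ^t* *m W in sE.
have GG : G ^t* *m G = G.
  by rewrite /G ctrmxM trmxCK mulmxA -[_ *m W *m W ^t*]mulmxA -mulmxA h.
have := gram_diag G i; rewrite GG sE => /complexI => H.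
have : s * s <= s.
  have -> : s * s = sqmod (G i i) by rewrite sE /sqmod /= expr0n addr0 expr2.
  rewrite [leRHS]H (bigD1 i) //= lerDl sumr_ge0 // => k _; exact: sqmod_ge0.
have : 0 <= s by apply: sumr_ge0 => k _; exact: sqmod_ge0.
move=> s0 ss; rewrite leNgt; apply/negP => s1.
have : s * 1 < s * s by rewrite ltr_pM2l // (lt_trans ltr01).
by rewrite mulr1 ltNge ss.
Qed.

(** Bessel's inequality: the columns of V span the range of the projection V
    V^H, so the columns of V^H W are no longer than those of W. *)
Lemma partial_isometry_bessel r n q (V : 'M[C]_(r, q)) (W : 'M[C]_(r, n)) i :
  partial_isometry V -> partial_isometry W ->
  \sum_j sqmod ((V ^t* *m W) j i) <= 1.
Proof.
move=> hV hW; apply: le_trans (partial_isometry_col i hW).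
have := gram_diag (W - V *m (V ^t* *m W)) i.
have -> : (W - V *m (V ^t* *m W)) ^t* *m (W - V *m (V ^t* *m W)) =
   W ^t* *m W - (V ^t* *m W) ^t* *m (V ^t* *m W).
  have hV' : V *m (V ^t* *m V) = V by rewrite mulmxA.
  rewrite ctrmxB !ctrmxM trmxCK mulmxBl !mulmxBr !mulmxA.
  by rewrite -!(mulmxA (W ^t*)) -(mulmxA V (V ^t*) V) hV' subrr subr0.
rewrite mxE [X in _ + X]mxE !gram_diag -rmorphB => /complexI H.
by rewrite -subr_ge0 H sumr_ge0 // => j _; exact: sqmod_ge0.
Qed.

Lemma partial_isometry_bessel_row r n q (V : 'M[C]_(r, q)) (W :
  'M[C]_(r, n)) j :
  partial_isometry V -> partial_isometry W ->
  \sum_i sqmod ((V ^t* *m W) j i) <= 1.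
Proof.
move=> hV hW; apply: le_trans (partial_isometry_bessel j hW hV).
rewrite le_eqVlt; apply/orP; left; apply/eqP; apply: eq_bigr => i _.
by rewrite -sqmod_ctrmx ctrmxM trmxCK.
Qed.

Local Notation overlap A B := (spectralmx A *m (spectralmx B) ^t*).

Lemma spectral_row_sum n (A B : 'M[C]_n) j :
  \sum_i sqmod ((overlap A B) j i) = 1.
Proof.
have := gram_diag ((overlap A B) ^t*) j.
rewrite trmxCK ctrmxM trmxCK mulmxA -[X in X *m _]mulmxA spectralmxK mulmx1
  spectralmxKV mxE eqxx.
move=> /complexI ->; apply: eq_bigr => i _.
by rewrite -sqmod_ctrmx ctrmxM trmxCK.
Qed.

Lemma spectral_col_sum n (A B : 'M[C]_n) j :
  \sum_i sqmod ((overlap A B) i j) = 1.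
Proof.
rewrite -(spectral_row_sum B A j); apply: eq_bigr => i _.
by rewrite -sqmod_ctrmx ctrmxM trmxCK.
Qed.

Lemma herm_form r n (Y : 'M[C]_(r, n)) (B : 'M[C]_n) j : B ^t* = B ->
  complex.Re ((Y *m B *m Y ^t*) j j) =
  \sum_i eigval B i * sqmod ((Y *m (spectralmx B) ^t*) j i).
Proof.
move=> Bh; have := rdiag_form (Y *m (spectralmx B) ^t*) (eigval B) j.
rewrite ctrmxM trmxCK !mulmxA => E.
by rewrite [X in _ *m X *m _](herm_spectral Bh) !mulmxA E.
Qed.

Lemma sum_eigval n (A : 'M[C]_n) : A ^t* = A -> \sum_j eigval A j =
  complex.Re (\tr A).
Proof.
move=> Ah; rewrite [in RHS](herm_spectral Ah) -mulmxA mxtrace_mulC -mulmxA.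
rewrite spectralmxKV mulmx1 Re_sum; apply: eq_bigr => j _.
by rewrite rdiagE eqxx.
Qed.

End PartialIsometries.

(** * Eigenvalues of a sum of positive matrices *)

Section SumPsd.
Context {R : realType} {m n : nat}.
Local Notation C := (R[i]).
Context (B : 'I_m -> 'M[C]_n) (Bp : forall k, psd (B k)).
Local Notation overlap A B := (spectralmx A *m (spectralmx B) ^t*).
Let BS := \sum_k B k.

Let BSp : psd BS. Proof. exact: psd_sum. Qed.

Lemma form_sum r (Y : 'M[C]_(r, n)) j :
  complex.Re ((Y *m BS *m Y ^t*) j j) =
  \sum_k complex.Re ((Y *m B k *m Y ^t*) j j).
Proof. by rewrite mulmx_sumr mulmx_suml summxE Re_sum. Qed.

Lemma sum_eigval_sum : \sum_k \sum_i eigval (B k) i = \sum_j eigval BS j.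
Proof.
rewrite (sum_eigval BSp.1) /BS (big_morph _ (@mxtraceD _ _) (@mxtrace0 _ _))
  Re_sum; apply: eq_bigr => k _.
by rewrite sum_eigval //; exact: (Bp k).1.
Qed.

Lemma sum_form_eigval j :
  \sum_k \sum_i eigval (B k) i * sqmod ((overlap (B k) BS) i j) = eigval BS j.
Proof.
rewrite -(eigval_diag j BSp.1) form_sum; apply: eq_bigr => k _.
rewrite (herm_form _ _ (Bp k).1); apply: eq_bigr => i _.
by rewrite -[in RHS]sqmod_ctrmx ctrmxM trmxCK.
Qed.

Lemma eigval_le_max k i : eigval (B k) i <= \big[Num.max/0]_j eigval BS j.
Proof.
rewrite -(eigval_diag i (Bp k).1).
apply: (@le_trans _ _ (complex.Re ((spectralmx (B k) *m BS *m
  (spectralmx (B k)) ^t*) i i))).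
  rewrite form_sum (bigD1 k) //= lerDl sumr_ge0 // => l _; exact: psd_form_diag.
rewrite (herm_form _ _ BSp.1).
set M := \big[Num.max/0]_j eigval BS j.
apply: (@le_trans _ _ (\sum_j M * sqmod ((overlap (B k) BS) i j))).
  apply: ler_sum => j _; rewrite ler_wpM2r ?sqmod_ge0 //.
  by rewrite /M; apply: le_bigmax.
by rewrite -mulr_sumr spectral_row_sum mulr1.
Qed.

(** With l = eigval (B k) i, u the corresponding eigenvector and BS the sum,
    this says l u u^H <= BS in the form l <u, BS^-1 u> <= 1, where BS^-1
    stands for the pseudo-inverse because the inverse of 0 is 0. Put s = <u,
    BS^-1 u> and y = BS^-1 u: then s = <y, BS y> >= <y, B_k y> >= l |<u, y>|^2
    = l s^2. *)
Lemma inv_weight_le1 k i :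
  eigval (B k) i * \sum_j (eigval BS j)^-1 * sqmod ((overlap (B k) BS) i j)
  <= 1.
Proof.
set M := overlap (B k) BS.
set s := \sum_j _; set l := eigval (B k) i.
have s0 : 0 <= s.
  by apply: sumr_ge0 => j _; rewrite mulr_ge0 ?sqmod_ge0 // invr_ge0 eigval_ge0.
have l0 : 0 <= l by exact: eigval_ge0.
pose D := rdiag (fun j => (eigval BS j)^-1).
pose Y := M *m D *m spectralmx BS.
have YB : complex.Re ((Y *m BS *m Y ^t*) i i) = s.
  rewrite (herm_form _ _ BSp.1); apply: eq_bigr => j _.
  rewrite /Y -(mulmxA (M *m D)) spectralmxKV mulmx1 mul_mx_rdiag.
  have -> : sqmod (M i j * ((eigval BS j)^-1)%:C) =
    sqmod (M i j) * (eigval BS j)^-1 ^+ 2.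
    by rewrite /sqmod; case: (M i j) => x y /=; ring.
  have [->|e0] := eqVneq (eigval BS j) 0; first by rewrite invr0 !mul0r.
  by field.
have YBk : l * s ^+ 2 <= complex.Re ((Y *m B k *m Y ^t*) i i).
  rewrite (herm_form _ _ (Bp k).1) (bigD1 i) //; apply: ler_wpDr.
    by apply: sumr_ge0 => j _; rewrite mulr_ge0 ?sqmod_ge0 // eigval_ge0.
  rewrite -/l ler_wpM2l //.
  have -> : Y *m (spectralmx (B k)) ^t* = M *m D *m M ^t*.
    by rewrite /Y /M ctrmxM trmxCK !mulmxA.
  by rewrite rdiag_form /sqmod /= expr0n addr0.
have : l * s ^+ 2 <= s.
  apply: le_trans YBk _; rewrite -[leRHS]YB form_sum (bigD1 k) //= lerDl
    sumr_ge0 // => q _.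
  exact: psd_form_diag.
move: s0; rewrite le_eqVlt => /predU1P[<-|s0]; first by rewrite mulr0.
by rewrite expr2 mulrA -ler_pdivlMr // divff // gt_eqF.
Qed.

(** McCarthy's inequality. Each eigenvalue of B k is a combination, with
    weights w of total mass at most 1 by [inv_weight_le1], of the eigenvalues
    of the sum, so Jensen's inequality applies; and each eigenvalue of the sum
    receives total weight at most 1 from all the B k together. *)
Lemma eigval_powR_superadd p : 1 <= p ->
  \sum_k \sum_i eigval (B k) i `^ p <= \sum_j eigval BS j `^ p.
Proof.
move=> p1.
pose c k i j := sqmod ((overlap (B k) BS) i j).
pose w k i j := eigval (B k) i * ((eigval BS j)^-1 * c k i j).
have c0 k i j : 0 <= c k i j by exact: sqmod_ge0.
have l0 k i : 0 <= eigval (B k) i by exact: eigval_ge0.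
have w0 k i j : 0 <= w k i j.
  by rewrite /w !mulr_ge0 // invr_ge0 eigval_ge0.
have wE k i : \sum_j w k i j * eigval BS j = eigval (B k) i.
  rewrite -[RHS]mulr1 -(spectral_row_sum (B k) BS i) mulr_sumr;
    apply: eq_bigr => j _.
  (* A null vector of the sum is a null vector of every B k. *)
  have [e0|e0] := eqVneq (eigval BS j) 0; last by rewrite /w /c; field.
  rewrite e0 mulr0; apply/esym/eqP; rewrite eq_le; apply/andP; split;
    last first.
    by rewrite mulr_ge0 // sqmod_ge0.
  rewrite -e0 -(sum_form_eigval j) (bigD1 k) //= (bigD1 i) //= -addrA lerDl
    addr_ge0 //.
    by apply: sumr_ge0 => q _; rewrite mulr_ge0 // sqmod_ge0.
  by apply: sumr_ge0 => q _; apply: sumr_ge0 => q' _;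
    rewrite mulr_ge0 // sqmod_ge0.
have h k i : eigval (B k) i `^ p <= \sum_j w k i j * eigval BS j `^ p.
  rewrite -{1}wE; apply: jensen_powR => // [j|]; first exact: eigval_ge0.
  by rewrite -mulr_sumr; exact: inv_weight_le1.
apply: (@le_trans _ _ (\sum_k \sum_i \sum_j w k i j * eigval BS j `^ p)).
  by apply: ler_sum => k _; apply: ler_sum => i _.
under eq_bigr do rewrite exchange_big /=.
rewrite exchange_big /=; apply: ler_sum => j _.
under eq_bigr do rewrite -mulr_suml.
rewrite -mulr_suml -[leRHS]mul1r ler_wpM2r ?powR_ge0 //.
have -> : \sum_k \sum_i w k i j = (eigval BS j)^-1 * eigval BS j.
  rewrite -[X in _ * X](sum_form_eigval j) mulr_sumr; apply: eq_bigr => k _.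
  by rewrite mulr_sumr; apply: eq_bigr => i _; rewrite /w mulrCA.
by have [->|e0] := eqVneq (eigval BS j) 0; rewrite ?mulr0 // mulVf.
Qed.
End SumPsd.

(** * The triangle inequality for rectangular matrices *)

Section Triangle.
Context {R : realType} {m n r : nat}.
Local Notation C := (R[i]).
Context (T : 'I_m -> 'M[C]_(r, n)) (B : 'I_m -> 'M[C]_n) (P : 'M[C]_n).
Context (Bp : forall k, psd (B k)) (BT : forall k, B k *m B k =
  (T k) ^t* *m T k).
Context (Pp : psd P) (PT : P *m P = (\sum_k T k) ^t* *m (\sum_k T k)).
Local Notation overlap A B := (spectralmx A *m (spectralmx B) ^t*).
Let BS := \sum_k B k.
Let BSp : psd BS. Proof. exact: psd_sum. Qed.
Local Notation mu := (eigval BS).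
Local Notation mumax := (\big[Num.max/0]_j eigval BS j).

(** The diagonal entries of the sum of the B k in the right singular basis of
    the sum of the T k. *)
Definition right_weight j : R := \sum_k \sum_i eigval (B k) i *
  sqmod ((overlap P (B k)) j i).

(** The diagonal entries, in the left singular basis V of the sum of the T k,
    of the sum of the moduli of the adjoints of the T k: if T k = W k L F is a
    singular value decomposition, then |(T k)^H| = W k L (W k)^H. *)
Definition left_weight (W : 'I_m -> 'M[C]_(r, n)) (V : 'M[C]_(r, n)) j : R :=
  \sum_k \sum_i eigval (B k) i * sqmod ((V ^t* *m W k) j i).

Lemma right_weight_form j :
  right_weight j = \sum_i mu i * sqmod ((overlap P BS) j i).
Proof.
rewrite -(herm_form _ _ BSp.1) (form_sum B); apply: eq_bigr => k _.
by rewrite (herm_form _ _ (Bp k).1).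
Qed.

Lemma right_weight_ge0 j : 0 <= right_weight j.
Proof.
by apply: sumr_ge0 => k _; apply: sumr_ge0 => i _;
  rewrite mulr_ge0 ?sqmod_ge0 ?eigval_ge0.
Qed.

Lemma left_weight_ge0 W V j : 0 <= left_weight W V j.
Proof.
by apply: sumr_ge0 => k _; apply: sumr_ge0 => i _;
  rewrite mulr_ge0 ?sqmod_ge0 ?eigval_ge0.
Qed.

(** The right weights are averages of the eigenvalues of the sum with doubly
    stochastic coefficients. *)
Lemma right_weight_powR p : 1 <= p ->
  \sum_j right_weight j `^ p <= \sum_i mu i `^ p.
Proof.
move=> p1; apply: (@le_trans _ _ (\sum_j \sum_i
    sqmod ((overlap P BS) j i) * mu i `^ p)).
  apply: ler_sum => j _; rewrite right_weight_form.
  under eq_bigr do rewrite mulrC.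
  apply: jensen_powR => // [i|i|]; rewrite ?sqmod_ge0 ?eigval_ge0 //.
  by rewrite spectral_row_sum.
rewrite exchange_big /=; apply: ler_sum => i _.
by rewrite -mulr_suml spectral_col_sum mul1r.
Qed.

Lemma right_weight_sum : \sum_j right_weight j = \sum_i mu i.
Proof.
under eq_bigr do rewrite right_weight_form.
rewrite exchange_big /=; apply: eq_bigr => i _.
by rewrite -mulr_sumr spectral_col_sum mulr1.
Qed.

Lemma right_weight_max j : right_weight j <= mumax.
Proof.
rewrite right_weight_form -[leRHS]mulr1 -(spectral_row_sum P BS j) mulr_sumr.
by apply: ler_sum => i _; rewrite ler_wpM2r ?sqmod_ge0 // le_bigmax.
Qed.

Section LeftWeight.
Context (W : 'I_m -> 'M[C]_(r, n)) (V : 'M[C]_(r, n)).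
Context (Wp : forall k, partial_isometry (W k)) (Vp : partial_isometry V).
Local Notation lw := (left_weight W V).

Lemma left_weight_sum : \sum_j lw j <= \sum_i mu i.
Proof.
rewrite -(sum_eigval_sum Bp) /left_weight exchange_big /=;
  apply: ler_sum => k _.
rewrite exchange_big /=; apply: ler_sum => i _.
by rewrite -mulr_sumr -[leRHS]mulr1 ler_wpM2l ?eigval_ge0 //
  partial_isometry_bessel.
Qed.

(** The total left weight is at most the trace of the sum, and a trace is a
    sum of n eigenvalues. *)
Lemma left_weight_powR_dim p : 1 <= p ->
  \sum_j lw j `^ p <= n%:R `^ (p - 1) * \sum_i mu i `^ p.
Proof.
move=> p1; apply: (le_trans (sum_powR_le p1 (left_weight_ge0 W V))).
apply: (@le_trans _ _ ((\sum_i mu i) `^ p)).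
  rewrite ge0_ler_powR ?nnegrE ?left_weight_sum //; first lra.
    by apply: sumr_ge0 => j _; exact: left_weight_ge0.
  by apply: sumr_ge0 => j _; exact: eigval_ge0.
have := @powR_sum_le R 'I_n p mu p1; rewrite card_ord; apply => i;
  exact: eigval_ge0.
Qed.

(** Convexity of the power over the m matrices produces the factor m ^ (p -
    1); Bessel's inequality then bounds the part of each matrix by the p-th
    powers of its own eigenvalues, which are superadditive. *)
Lemma left_weight_powR_num p : 1 <= p ->
  \sum_j lw j `^ p <= m%:R `^ (p - 1) * \sum_i mu i `^ p.
Proof.
move=> p1; pose c k j := \sum_i eigval (B k) i * sqmod ((V ^t* *m W k) j i).
have c0 k j : 0 <= c k j.
  by apply: sumr_ge0 => i _; rewrite mulr_ge0 ?sqmod_ge0 ?eigval_ge0.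
apply: (@le_trans _ _ (\sum_j m%:R `^ (p - 1) * \sum_k c k j `^ p)).
  apply: ler_sum => j _; rewrite -[m in m%:R]card_ord.
  exact: (powR_sum_le p1 (c0^~ j)).
rewrite -mulr_sumr ler_wpM2l ?powR_ge0 //.
apply: le_trans (eigval_powR_superadd Bp p1).
rewrite exchange_big /=; apply: ler_sum => k _.
apply: (@le_trans _ _ (\sum_j \sum_i sqmod ((V ^t* *m
  W k) j i) * eigval (B k) i `^ p)).
  apply: ler_sum => j _; rewrite /c; under eq_bigr do rewrite mulrC.
  apply: jensen_powR => // [i|i|]; rewrite ?sqmod_ge0 ?eigval_ge0 //.
  exact: partial_isometry_bessel_row.
rewrite exchange_big /=; apply: ler_sum => i _.
by rewrite -mulr_suml -[leRHS]mul1r ler_wpM2r ?powR_ge0 //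
  partial_isometry_bessel.
Qed.

Lemma left_weight_max_dim j : lw j <= n%:R * mumax.
Proof.
apply: (@le_trans _ _ (\sum_i mu i)).
  apply: le_trans left_weight_sum; rewrite (bigD1 j) //= lerDl sumr_ge0 //
    => i _.
  exact: left_weight_ge0.
rewrite -[n in n%:R]card_ord mulr_natl -sumr_const; apply: ler_sum => i _.
exact: le_bigmax.
Qed.

Lemma left_weight_max_num j : lw j <= m%:R * mumax.
Proof.
rewrite -[m in m%:R]card_ord mulr_natl -sumr_const; apply: ler_sum => k _.
apply: (@le_trans _ _ (\sum_i mumax * sqmod ((V ^t* *m W k) j i))).
  by apply: ler_sum => i _; rewrite ler_wpM2r ?sqmod_ge0 // eigval_le_max.
rewrite -mulr_sumr -[leRHS]mulr1 ler_wpM2l //;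
  last exact: partial_isometry_bessel_row.
by apply: bigmax_ge_id.
Qed.

Context (TW : forall k, T k = W k *m rdiag (eigval (B k)) *m spectralmx (B k)).
Context (TV : \sum_k T k = V *m rdiag (eigval P) *m spectralmx P).
Context (VV : V ^t* *m V *m rdiag (eigval P) = rdiag (eigval P)).

(** The singular value is a diagonal entry of the adjoint of V times the sum
    times the adjoint of the right eigenvectors; each product of two entries
    in its expansion is split by the inequality of arithmetic and geometric
    means. *)
Lemma eigval_le_weights t j : 0 < t -> 2 * eigval P j <=
  t * right_weight j + lw j / t.
Proof.
move=> t0; have -> : eigval P j = complex.Re ((V ^t* *m (\sum_k T k) *m
  (spectralmx P) ^t*) j j).
  by rewrite TV !mulmxA VV -mulmxA spectralmxKV mulmx1 rdiagE eqxx.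
rewrite mulmx_sumr mulmx_suml summxE Re_sum /right_weight /left_weight.
rewrite !mulr_sumr mulr_suml -big_split /=; apply: ler_sum => k _.
have -> : V ^t* *m T k *m (spectralmx P) ^t* =
   (V ^t* *m W k) *m rdiag (eigval (B k)) *m (overlap P (B k)) ^t*.
  by rewrite TW ctrmxM trmxCK !mulmxA.
set X := V ^t* *m W k; set Y := spectralmx P *m _.
rewrite mxE Re_sum !mulr_sumr mulr_suml -big_split /=; apply: ler_sum => i _.
rewrite mul_mx_rdiag mulrAC [Z in complex.Re Z]mulrC Re_scale.
have := Re_mul_le (X j i) ((Y ^t*) i j) t0; rewrite sqmod_ctrmx => h.
have := ler_wpM2l (eigval_ge0 i (Bp k)) h; lra.
Qed.

Lemma eigval_sqr_le_weights j : eigval P j ^+ 2 <= lw j * right_weight j.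
Proof.
apply: le_sqr_mul; rewrite ?eigval_ge0 ?left_weight_ge0 ?right_weight_ge0 //
  => t t0.
exact: eigval_le_weights.
Qed.

(** The Hilbert-Schmidt norm of the sum is expanded into the inner products f
    k l of T k and T l. Those with l = k add up to the sum dd of all squared
    eigenvalues of the B k. For distinct k and l, 2 f k l <= t (d k + d l) / 2
    + q k l / t, where the q k l, including the q k k = d k, add up to the sum
    h of the squared eigenvalues of the sum of the B k. Altogether, twice the
    left-hand side is at most 2 dd + t (m - 1) dd + (h - dd) / t, and t = 1 /
    (1 + sqrt m) is the value at which dd cancels. *)
Lemma sum_eigval_sqr_le_num :
  \sum_j eigval P j ^+ 2 <= (1 + Num.sqrt m%:R) / 2 * \sum_j mu j ^+ 2.
Proof.
pose d k := \sum_i eigval (B k) i ^+ 2.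
pose q k l := \sum_i \sum_i' eigval (B k) i * eigval (B l) i' *
  sqmod ((overlap (B k) (B l)) i i').
pose f k l := complex.Re (\tr ((T k) ^t* *m T l)).
have sqrE (A : 'M[C]_n) : A ^t* = A -> complex.Re (\tr (A *m A)) =
  \sum_j eigval A j ^+ 2.
  move=> Ah; rewrite (herm_sqr Ah) -mulmxA mxtrace_mulC -mulmxA spectralmxKV
    mulmx1 Re_sum.
  by apply: eq_bigr => j _; rewrite rdiagE eqxx expr2.
have fE : \sum_j eigval P j ^+ 2 = \sum_k \sum_l f k l.
  rewrite -(sqrE _ Pp.1) PT ctrmx_sum mulmx_suml.
  rewrite (big_morph _ (@mxtraceD _ _) (@mxtrace0 _ _)) Re_sum;
    apply: eq_bigr => k _.
  rewrite mulmx_sumr (big_morph _ (@mxtraceD _ _) (@mxtrace0 _ _)) Re_sum.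
  by apply: eq_bigr.
have fdiag k : f k k = d k by rewrite /f -BT sqrE //; exact: (Bp k).1.
have qdiag k : q k k = d k.
  apply: eq_bigr => i _; rewrite (bigD1 i) //= big1 ?addr0 => [|i' ne].
    by rewrite spectralmxKV mxE eqxx /sqmod /= expr1n expr0n addr0 mulr1 expr2.
  by rewrite spectralmxKV mxE eq_sym (negbTE ne) /sqmod /= expr0n addr0 mulr0.
have qsum : \sum_k \sum_l q k l = \sum_j mu j ^+ 2.
  have qE k : \sum_l q k l = \sum_i eigval (B k) i *
      complex.Re ((spectralmx (B k) *m BS *m (spectralmx (B k)) ^t*) i i).
    rewrite exchange_big /=; apply: eq_bigr => i _;
      rewrite form_sum mulr_sumr; apply: eq_bigr => l _.
    rewrite (herm_form _ _ (Bp l).1) mulr_sumr; apply: eq_bigr => i' _.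
    by rewrite mulrA.
  under eq_bigr do rewrite qE.
  transitivity (\sum_j mu j *
      \sum_k \sum_i eigval (B k) i * sqmod ((overlap (B k) BS) i j)).
    under [RHS]eq_bigr do rewrite mulr_sumr.
    rewrite [RHS]exchange_big /=; apply: eq_bigr => k _.
    under [RHS]eq_bigr do rewrite mulr_sumr.
    rewrite [RHS]exchange_big /=; apply: eq_bigr => i _.
    rewrite (herm_form _ _ BSp.1) mulr_sumr; apply: eq_bigr => j _.
    by rewrite mulrCA.
  by apply: eq_bigr => j _; rewrite (sum_form_eigval Bp) expr2.
have fle k l t : 0 < t -> 2 * f k l <= t * ((d k + d l) / 2) + q k l / t.
  move=> t0.
  pose X := (W k) ^t* *m W l; pose Y := overlap (B k) (B l).
  have -> : f k l = complex.Re (\tr (rdiag (eigval (B k)) *m X *m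
    rdiag (eigval (B l)) *m Y ^t*)).
    rewrite /f !TW !ctrmxM ctrmx_rdiag trmxCK -!mulmxA mxtrace_mulC.
    by rewrite /X !mulmxA.
  have h1 : \sum_i \sum_i' eigval (B k) i * eigval (B l) i' * sqmod (X i i') <=
    (d k + d l) / 2.
    apply: (@le_trans _ _ (\sum_i \sum_i' (eigval (B k) i ^+ 2 +
      eigval (B l) i' ^+ 2) / 2 * sqmod (X i i'))).
      apply: ler_sum => i _; apply: ler_sum => i' _;
        rewrite ler_wpM2r ?sqmod_ge0 //.
      have := sqr_ge0 (eigval (B k) i - eigval (B l) i'); rewrite sqrrB; lra.
    have -> : \sum_i \sum_i' (eigval (B k) i ^+ 2 +
      eigval (B l) i' ^+ 2) / 2 * sqmod (X i i') =
       ((\sum_i eigval (B k) i ^+ 2 * \sum_i' sqmod (X i i')) +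
        \sum_i' eigval (B l) i' ^+ 2 * \sum_i sqmod (X i i')) / 2.
      under [X in X + _]eq_bigr do rewrite mulr_sumr.
      under [X in _ + X]eq_bigr do rewrite mulr_sumr.
      rewrite [X in _ + X]exchange_big /= -big_split mulr_suml;
        apply: eq_bigr => i _ /=.
      by rewrite -big_split mulr_suml; apply: eq_bigr => i' _ /=; ring.
    rewrite ler_wpM2r // lerD // /d; apply: ler_sum => i _;
      rewrite -[leRHS]mulr1 ler_wpM2l ?sqr_ge0 //.
      exact: partial_isometry_bessel_row.
    exact: partial_isometry_bessel.
  have h2 : 2 * complex.Re (\tr (rdiag (eigval (B k)) *m X *m
    rdiag (eigval (B l)) *m Y ^t*)) <=
      t * (\sum_i \sum_i' eigval (B k) i * eigval (B l) i' * sqmod (X i i')) +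
        q k l / t.
    rewrite Re_sum /q !mulr_sumr mulr_suml -big_split /=; apply: ler_sum => i _.
    rewrite mxE Re_sum !mulr_sumr mulr_suml -big_split /=;
      apply: ler_sum => i' _.
    rewrite mul_mx_rdiag mul_rdiag_mx.
    have -> :
        (eigval (B k) i)%:C * X i i' * (eigval (B l) i')%:C * (Y ^t*) i' i =
        (eigval (B k) i * eigval (B l) i')%:C * (X i i' * (Y ^t*) i' i).
      by rewrite rmorphM /=; ring.
    rewrite Re_scale.
    have := Re_mul_le (X i i') ((Y ^t*) i' i) (_ : 0 < t^-1);
      rewrite sqmod_ctrmx invrK invr_gt0 => /(_ t0) h.
    have := ler_wpM2l (mulr_ge0 (eigval_ge0 i (Bp k)) (eigval_ge0 i' (Bp l))) h.
    by lra.
  apply: le_trans h2 _; rewrite lerD2r ler_wpM2l // ltW //.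
set s := Num.sqrt m%:R; have s0 : 0 <= s by exact: sqrtr_ge0.
have ss : s * s = m%:R by rewrite -expr2 sqr_sqrtr.
pose t := (1 + s)^-1; have t0 : 0 < t by rewrite invr_gt0; lra.
pose dd := \sum_k d k.
have fle' k l : 2 * f k l <= t / 2 * (d k + d l) + q k l / t +
  (2 * d k - (t * d k + d k / t)) *+ (k == l).
  have [<-|_] := eqVneq k l; first by rewrite fdiag qdiag mulr1n; lra.
  by rewrite mulr0n addr0; have := fle k l t t0; lra.
have : 2 * \sum_k \sum_l f k l <= \sum_k \sum_l (t / 2 * (d k + d l) +
  q k l / t +
    (2 * d k - (t * d k + d k / t)) *+ (k == l)).
  by rewrite mulr_sumr; apply: ler_sum => k _; rewrite mulr_sumr;
    apply: ler_sum => l _; exact: fle'.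
have -> : \sum_k \sum_l (t / 2 * (d k + d l) + q k l / t +
    (2 * d k - (t * d k + d k / t)) *+ (k == l)) =
    t * (m%:R * dd) + (\sum_j mu j ^+ 2) / t + (2 * dd - (t * dd + dd / t)).
  have ind k (c : R) : \sum_(l < m) c *+ (k == l) = c.
    by rewrite (bigD1 k) //= eqxx mulr1n big1 ?addr0 // => l /negbTE;
      rewrite eq_sym => ->.
  have sumE k : \sum_l (t / 2 * (d k + d l) + q k l / t +
    (2 * d k - (t * d k + d k / t)) *+ (k == l)) =
     t / 2 * (m%:R * d k + dd) + (\sum_l q k l) / t + (2 * d k - (t * d k +
       d k / t)).
    rewrite !big_split /= -mulr_sumr -mulr_suml big_split /= sumr_const
      card_ord -[d k *+ m]mulr_natl.
    by rewrite ind.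
  under eq_bigr do rewrite sumE.
  rewrite !big_split /= -mulr_sumr -mulr_suml big_split /= qsum sumr_const
    card_ord.
  rewrite -[dd *+ m]mulr_natl sumrN big_split /= -!mulr_sumr -mulr_suml -/dd.
  by lra.
have -> : (\sum_j mu j ^+ 2) / t = (1 + s) * \sum_j mu j ^+ 2
  by rewrite /t invrK mulrC.
have tE : t * (1 + s) = 1 by rewrite mulVf // gt_eqF //; lra.
have -> : t * (m%:R * dd) + (1 + s) * \sum_j mu j ^+ 2 + (2 * dd - (t * dd +
  dd / t)) = (1 + s) * \sum_j mu j ^+ 2.
  have -> : dd / t = (1 + s) * dd by rewrite /t invrK mulrC.
  have -> : t * (m%:R * dd) = (t * (1 + s)) * ((s - 1) * dd) + t * dd
    by rewrite -ss; ring.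
  by rewrite tE; ring.
by rewrite fE; lra.
Qed.

End LeftWeight.
End Triangle.

Section SchattenTriangle.
Context {R : realType} {m n r : nat}.
Local Notation C := (R[i]).
Context (T : 'I_m -> 'M[C]_(r, n)) (B : 'I_m -> 'M[C]_n) (P : 'M[C]_n).
Context (Bp : forall k, psd (B k)) (BT : forall k, B k *m B k =
  (T k) ^t* *m T k).
Context (Pp : psd P) (PT : P *m P = (\sum_k T k) ^t* *m (\sum_k T k)).
Context (m0 : (0 < m)%N) (n0 : (0 < n)%N).
Local Notation N := (minn m n).

Let BSp : psd (\sum_k B k). Proof. exact: psd_sum. Qed.
Let N0 : (0 < N)%N. Proof. by rewrite leq_min m0. Qed.

Lemma polar_family : exists (W : 'I_m -> 'M[C]_(r, n)) (V : 'M[C]_(r, n)),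
  [/\ forall k, partial_isometry (W k), partial_isometry V,
      forall k, T k = W k *m rdiag (eigval (B k)) *m spectralmx (B k),
      \sum_k T k = V *m rdiag (eigval P) *m spectralmx P &
      V ^t* *m V *m rdiag (eigval P) = rdiag (eigval P)].
Proof.
have [V [TV Vp VV]] := polar_psd Pp PT.
have /choice[W HW] := fun k => polar_psd (Bp k) (BT k).
by exists W, V; split => // k; have [] := HW k.
Qed.

Lemma schatten_triangle p : 1 <= p ->
  schatten_norm p%:E P <=
  N%:R `^ (2^-1 - (2 * p)^-1) * schatten_norm p%:E (\sum_k B k).
Proof.
move=> p1; have [W [V [Wp Vp TW TV VV]]] := polar_family.
rewrite !schatten_norm_psd //.
apply: (@schatten_scalar _ _ _ _ _ _ (left_weight B W V) (right_weight B P)) =>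
  //.
- by apply: sumr_ge0 => j _; exact: powR_ge0.
- by move=> j; exact: eigval_ge0.
- by move=> j; exact: left_weight_ge0.
- by move=> j; exact: right_weight_ge0.
- by move=> j; exact: eigval_sqr_le_weights.
- exact: right_weight_powR.
- rewrite /minn; case: ifP => _; first exact: left_weight_powR_num.
  exact: left_weight_powR_dim.
Qed.

Lemma schatten_triangle_infty :
  schatten_norm +oo%E P <= Num.sqrt N%:R * schatten_norm +oo%E (\sum_k B k).
Proof.
have [W [V [Wp Vp TW TV VV]]] := polar_family.
rewrite !schatten_norm_psdy //; set M :=
  \big[Num.max/0]_j eigval (\sum_k B k) j.
have M0 : 0 <= M by exact: bigmax_ge_id.
apply: bigmax_le => [|j _]; first by rewrite mulr_ge0 ?sqrtr_ge0.
have lwM : left_weight B W V j <= N%:R * M.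
  rewrite /minn; case: ifP => _; first exact: left_weight_max_num.
  exact: left_weight_max_dim.
rewrite -(ler_pXn2r (n := 2)) ?nnegrE ?mulr_ge0 ?sqrtr_ge0 ?eigval_ge0 //.
apply: (le_trans (eigval_sqr_le_weights Bp Pp TW TV VV j)).
rewrite exprMn sqr_sqrtr ?ler0n // [M ^+ 2]expr2 mulrA.
by apply: ler_pM; rewrite ?left_weight_ge0 ?right_weight_ge0 ?right_weight_max.
Qed.

Lemma schatten_triangle2 :
  schatten_norm 2%:E P <=
  Num.sqrt ((1 + Num.sqrt N%:R) / 2) * schatten_norm 2%:E (\sum_k B k).
Proof.
have [W [V [Wp Vp TW TV VV]]] := polar_family.
have sqE (A : 'M[C]_n) : psd A ->
    schatten_norm 2%:E A = Num.sqrt (\sum_j eigval A j ^+ 2).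
  move=> Ap; rewrite schatten_norm_psd // powR12_sqrt; last first.
    by apply: sumr_ge0 => j _; exact: powR_ge0.
  by congr Num.sqrt; apply: eq_bigr => j _; rewrite powR_mulrn ?eigval_ge0.
rewrite !sqE // -sqrtrM; last by rewrite divr_ge0 // addr_ge0 ?sqrtr_ge0.
apply: ler_wsqrtr.
rewrite /minn; case: ifP => _; first exact: sum_eigval_sqr_le_num TW.
apply: (@le_trans _ _ ((1 + Num.sqrt n%:R) / 2 * \sum_j right_weight B P j ^+
  2)).
  apply: (@frobenius_scalar _ _ _ (left_weight B W V)) => //.
  - by move=> j; exact: eigval_ge0.
  - by move=> j; exact: left_weight_ge0.
  - by move=> j; exact: right_weight_ge0.
  - by move=> j; exact: eigval_sqr_le_weights.
  - by rewrite right_weight_sum // left_weight_sum.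
rewrite ler_wpM2l // ?divr_ge0 ?addr_ge0 ?sqrtr_ge0 //.
have := right_weight_powR P Bp (_ : 1 <= 2); rewrite ler1n => /(_ isT).
under eq_bigr do rewrite powR_mulrn ?right_weight_ge0 //.
by under [X in _ <= X]eq_bigr do rewrite powR_mulrn ?eigval_ge0 //.
Qed.
End SchattenTriangle.

(** * The quadratic symmetric modulus as a modulus *)

Section Qsym.
Context {R : realType}.
Local Notation C := (R[i]).

(** The Gram matrix of this 2n x n matrix is the average of Z^H Z and Z Z^H,
    so its modulus is the quadratic symmetric modulus of Z; and it is additive
    in Z, which that modulus is not. *)
Definition qlift n (Z : 'M[C]_n) : 'M[C]_(n + n, n) :=
  (Num.sqrt 2^-1)%:C *: col_mx Z (Z ^t*).

Lemma qlift_sum m n (A : 'I_m -> 'M[C]_n) :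
  qlift (\sum_k A k) = \sum_k qlift (A k).
Proof.
rewrite /qlift -scaler_sumr ctrmx_sum; congr (_ *: _).
elim/big_rec3: _ => [|k x y z _ <-]; first by rewrite col_mx0.
by rewrite add_col_mx.
Qed.

Lemma qlift_gram n (Z : 'M[C]_n) :
  (qlift Z) ^t* *m qlift Z = 2^-1 *: (Z ^t* *m Z + Z *m Z ^t*).
Proof.
have ctrZ (a : R) q s (M : 'M[C]_(q, s)) : (a%:C *: M) ^t* = a%:C *: M ^t*.
  by apply/matrixP => i j; rewrite !mxE rmorphM /= conj_Creal //;
    apply/complex_realP; eexists.
rewrite /qlift ctrZ -scalemxAl -scalemxAr scalerA -rmorphM -expr2 sqr_sqrtr
  ?invr_ge0 //.
rewrite fmorphV rmorph_nat.
rewrite tr_col_mx map_row_mx mul_row_col; congr (_ *: (_ + _ *m _)).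
exact: trmxCK.
Qed.

Lemma mxabs_sqr n (Z : 'M[C]_n) : mxabs Z ^+ 2 = Z ^t* *m Z.
Proof. by rewrite expr2; have [_ <-] := mxsqrtP (psd_gram Z). Qed.

Lemma mxabs_qsymP n (Z : 'M[C]_n) : psd (mxabs_qsym Z) /\
  mxabs_qsym Z *m mxabs_qsym Z = (qlift Z) ^t* *m qlift Z.
Proof.
rewrite /mxabs_qsym !mxabs_sqr trmxCK -qlift_gram; apply: mxsqrtP;
  exact: psd_gram.
Qed.

Lemma mxabs_qsym0 n : mxabs_qsym (0 : 'M[C]_n) = 0.
Proof.
have [[Bh _] B2] := mxabs_qsymP (0 : 'M[C]_n).
apply: gram_eq0; rewrite Bh B2 qlift_gram mulmx0 mul0mx addr0 scaler0;
  reflexivity.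
Qed.

Lemma schatten_norm_ge0 n p (B : 'M[C]_n) : psd B -> 0 <= schatten_norm p B.
Proof.
case: p => [p||] Bp //; first by rewrite schatten_norm_psd // powR_ge0.
by rewrite schatten_norm_psdy //; exact: bigmax_ge_id.
Qed.

Lemma schatten_norm_gt0 n p (B : 'M[C]_n) : (1 <= p)%E -> psd B -> B != 0 ->
  0 < schatten_norm p B.
Proof.
move=> p1 Bp B0; have [j ej] : exists j, 0 < eigval B j.
  apply/not_existsP => e; move/negP: B0; apply; apply/eqP.
  rewrite (herm_spectral Bp.1); have -> : rdiag (eigval B) = 0.
    apply/matrixP => i j; rewrite rdiagE mxE.
    have -> : eigval B i = 0; last by rewrite mul0rn.
    by apply/eqP; rewrite eq_le eigval_ge0 // andbT leNgt; apply/negP/e.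
  by rewrite mulmx0 mul0mx.
case: p p1 => [p||] p1 //.
- rewrite schatten_norm_psd // powR_gt0 // (bigD1 j) //= ltr_wpDr ?powR_gt0 //.
  by apply: sumr_ge0 => i _; exact: powR_ge0.
- by rewrite schatten_norm_psdy //; apply: (lt_le_trans ej); exact: le_bigmax.
Qed.

Lemma mxabs_qsym1_neq0 n : (0 < n)%N -> mxabs_qsym (1%:M : 'M[C]_n) != 0.
Proof.
move=> n0; apply/eqP => E0; have [_] := mxabs_qsymP (1%:M : 'M[C]_n).
rewrite E0 mulmx0 qlift_gram mulmx1 => /matrixP/(_ (Ordinal n0) (Ordinal n0)).
rewrite mul1mx !mxE eqxx /= conjC1 => /eqP; rewrite eq_sym mulf_eq0 invr_eq0.
by rewrite (pnatr_eq0 C 2).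
Qed.

(** Tested on the family consisting of one identity matrix and zeros, for
    which both sides of the triangle inequality have the same norm. *)
Lemma qsym_constant_ge1 p m n c : (1 <= p)%E -> (0 < m)%N -> (0 < n)%N ->
  qsym_triangle_constants p m n c -> 1 <= c :> R.
Proof.
case: m => // m p1 _ n0 /(_ (fun k => if k == ord0 then 1%:M else 0)).
rewrite !big_ord_recl /= !big1 // => [|i _]; last by rewrite mxabs_qsym0.
rewrite !addr0 => h.
have N0 : 0 < schatten_norm p (mxabs_qsym (1%:M : 'M[C]_n)).
  by rewrite schatten_norm_gt0 ?mxabs_qsym1_neq0 //;
    have [] := mxabs_qsymP (1%:M : 'M[C]_n).
by rewrite -(ler_pM2r N0) mul1r.
Qed.
End Qsym.

(** * The best constants *)

Section Constants.
Context {R : realType} {m n : nat}.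
Context (m0 : (0 < m)%N) (n0 : (0 < n)%N).
Local Notation N := (minn m (2 * n)).

Let psd_sum_qsym (A : 'I_m -> 'M[R[i]]_n) : psd (\sum_k mxabs_qsym (A k)).
Proof. by apply: psd_sum => k; have [] := mxabs_qsymP (A k). Qed.

Let minn_le : ((minn m n)%:R : R) <= N%:R.
Proof. by rewrite ler_nat leq_min geq_minl /= (leq_trans (geq_minr _ _)) //
  leq_pmull. Qed.

Lemma qsym_constants_mono (p : \bar R) (c d : R) : c <= d ->
  qsym_triangle_constants p m n c -> qsym_triangle_constants p m n d.
Proof.
move=> cd h A; apply: (le_trans (h A)); rewrite ler_wpM2r //.
exact: schatten_norm_ge0.
Qed.

Lemma qsym_constant_powR (p : \bar R) : (1 <= p)%E ->
  qsym_triangle_constants p m n (N%:R `^ (2^-1 - fine ((2%:E * p)^-1)%E) : R).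
Proof.
case: p => [p||] //; rewrite ?lee_fin => p1.
  have -> : fine ((2%:E * p%:E)^-1)%E = (2 * p)^-1 :> R.
    by rewrite -EFinM inver gt_eqF //; lra.
  apply: (@qsym_constants_mono _ ((minn m n)%:R `^ (2^-1 - (2 * p)^-1))).
    apply: ge0_ler_powR; rewrite ?nnegrE ?ler0n //.
    by rewrite subr_ge0 lef_pV2 ?posrE; lra.
  move=> A; apply: (@schatten_triangle _ _ _ _ (fun k => qlift (A k))) => //.
  - by move=> k; have [] := mxabs_qsymP (A k).
  - by move=> k; have [] := mxabs_qsymP (A k).
  - by have [] := mxabs_qsymP (\sum_k A k).
  - by rewrite -qlift_sum; have [] := mxabs_qsymP (\sum_k A k).
have -> : fine ((2%:E * +oo)^-1)%E = 0 :> R.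
  by rewrite gt0_muley ?lte_fin // invey.
rewrite subr0 powR12_sqrt ?ler0n //.
apply: (@qsym_constants_mono _ (Num.sqrt (minn m n)%:R));
  first exact: ler_wsqrtr.
move=> A; apply: (@schatten_triangle_infty _ _ _ _ (fun k =>
  qlift (A k))) => //.
- by move=> k; have [] := mxabs_qsymP (A k).
- by move=> k; have [] := mxabs_qsymP (A k).
- by have [] := mxabs_qsymP (\sum_k A k).
- by rewrite -qlift_sum; have [] := mxabs_qsymP (\sum_k A k).
Qed.

Lemma qsym_constant2 :
  qsym_triangle_constants 2%:E m n (Num.sqrt ((1 + Num.sqrt N%:R) / 2) : R).
Proof.
apply: (@qsym_constants_mono _ (Num.sqrt ((1 + Num.sqrt (minn m n)%:R) / 2))).
  by apply: ler_wsqrtr; rewrite ler_wpM2r // lerD2l ler_wsqrtr.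
move=> A; apply: (@schatten_triangle2 _ _ _ _ (fun k => qlift (A k))) => //.
- by move=> k; have [] := mxabs_qsymP (A k).
- by move=> k; have [] := mxabs_qsymP (A k).
- by have [] := mxabs_qsymP (\sum_k A k).
- by rewrite -qlift_sum; have [] := mxabs_qsymP (\sum_k A k).
Qed.

Lemma c_qsym_lbound (p : \bar R) : (1 <= p)%E ->
  lbound (qsym_triangle_constants p m n) (c_qsym p m n).
Proof. by move=> p1; apply: ge_inf; exists 1 => c;
  exact: qsym_constant_ge1. Qed.

(** For each family the inequality is a closed condition on the constant, so
    it passes to the infimum. When the right-hand norm vanishes, any
    admissible constant shows that the left-hand norm vanishes too. *)
Lemma c_qsym_mem (p : \bar R) : (1 <= p)%E ->
  qsym_triangle_constants p m n (c_qsym p m n).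
Proof.
move=> p1 A; have K := qsym_constant_powR p1.
have := schatten_norm_ge0 p (psd_sum_qsym A); rewrite le_eqVlt =>
  /predU1P[S0|S0].
  by have := K A; rewrite -S0 !mulr0.
rewrite -ler_pdivrMr //; apply: lb_le_inf; first
  by exists (N%:R `^ (2^-1 - fine ((2%:E * p)^-1)%E)).
by move=> c /(_ A); rewrite ler_pdivrMr.
Qed.
End Constants.

Theorem theorem8p3 (R : realType) (m n : nat) (hm : (2 <= m)%N)
    (hn : (2 <= n)%N) :
  (* for each p, c_qsym p m n is the smallest admissible constant *)
  (forall p : \bar R, (1 <= p)%E ->
     qsym_triangle_constants p m n (c_qsym p m n) /\
     lbound (qsym_triangle_constants p m n) (c_qsym p m n)) /\
  [/\ c_qsym (1%E : \bar R) m n = 1,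
      c_qsym (2%:E : \bar R) m n <=
        Num.sqrt ((1 + Num.sqrt (minn m (2 * n))%:R) / 2),
      c_qsym (+oo%E : \bar R) m n <= Num.sqrt (minn m (2 * n))%:R &
      forall p : \bar R, (1 <= p)%E ->
        c_qsym p m n <=
          (minn m (2 * n))%:R `^ (2^-1 - fine ((2%:E * p)^-1)%E)].
Proof.
have m0 : (0 < m)%N by exact: ltnW. have n0 : (0 < n)%N by exact: ltnW.
have lb (p : \bar R) (p1 : (1 <= p)%E) := c_qsym_lbound m0 n0 p1.
have bound (p : \bar R) (p1 : (1 <= p)%E) := lb p p1 _
  (qsym_constant_powR m0 n0 p1).
have le1y : (1 <= +oo :> \bar R)%E by rewrite leey.
split; first by move=> p p1; split; [exact: c_qsym_mem | exact: lb].
split => //.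
- apply/eqP; rewrite eq_le; apply/andP; split; last first.
    by apply: (qsym_constant_ge1 _ m0 n0 (c_qsym_mem m0 n0 _)).
  apply: (le_trans (bound _ _)) => //.
  by rewrite mule1 inver pnatr_eq0 /= subrr powRr0.
- by apply: lb; [rewrite lee_fin ler1n | exact: qsym_constant2].
- apply: (le_trans (bound _ le1y)).
  by rewrite gt0_muley ?lte_fin // invey subr0 powR12_sqrt ?ler0n.
Qed.
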